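(* Let $\mathcal{G}$ be an arbitrary connected graph with $N$ vertices and $e$ edges, with incidence matrix $B$ (for some orientation) and Laplacian $L = BB^T$, and consider the unperturbed Kuramoto model $$\dot\theta = -\frac{K}{N}\, B \sin(B^T\theta).$$ For any value of the coupling $K>0$, all trajectories converge to the set of equilibrium solutions. In particular, the synchronized state is locally asymptotically stable. Moreover, the rate of approach to the synchronized state is no worse than $$\frac{2K}{\pi N}\,\lambda_2(L),$$ where $\lambda_2(L)$ is the algebraic connectivity of the graph.
   Context: The graph is undirected; after choosing an arbitrary orientation of its edges, its incidence matrix $B$ is the $N\times e$ matrix with $B_{ij}=1$ if edge $j$ is incoming to vertex $i$, $B_{ij}=-1$ if edge $j$ is outgoing from vertex $i$, and $B_{ij}=0$ otherwise. The Laplacian $L=BB^T$ does not depend on the orientation; $\lambda_2(L)$ denotes its second smallest eigenvalue (the Fiedler eigenvalue or algebraic connectivity), which is its smallest nonzero eigenvalue for a connected graph. The vector $\theta=(\theta_1,\dots,\theta_N)^T$ collects the oscillator phases, which are angles, so the state moves on the $N$-torus; $\sin$ of a vector is taken componentwise. An equilibrium solution is a $\theta$ at which the right-hand side vanishes. The synchronized state is the set of states in which all phases are equal, $\theta=\theta_0\mathbf{1}_N$ with $\theta_0$ a constant and $\mathbf{1}_N$ the all-ones vector; stability and convergence are understood with respect to this set, i.e. modulo adding a common constant to all phases. ''The rate of approach to the synchronized state is no worse than $c$'' means that, for initial conditions sufficiently close to the synchronized state, the component $\theta_{\mathbf{1}^\perp}$ of (the nearby real lift of) $\theta$ orthogonal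 to $\mathbf{1}_N$ decays exponentially with rate at least $c$, i.e. $\|\theta_{\mathbf{1}^\perp}(t)\|_2$ is bounded by a constant times $e^{-ct}$ for $t\ge 0$. *)

(* Defs.v *)
From HB Require Import structures.
From mathcomp Require Import all_boot all_order all_algebra.
From mathcomp Require Import all_classical all_reals all_analysis.
From mathcomp Require polyrcf.

Set Implicit Arguments.
Unset Strict Implicit.
Unset Printing Implicit Defensive.

Import Order.TTheory GRing.Theory Num.Theory.
Import numFieldNormedType.Exports.

Local Open Scope classical_set_scope.
Local Open Scope ring_scope.

Definition simple_graph (N : nat) (adj : rel 'I_N) : Prop :=
  symmetric adj /\ irreflexive adj.

Definition connected_graph (N : nat) (adj : rel 'I_N) : Prop :=
  forall x y, connect adj x y.

(* The edges are numbered by 'I_e, edge j being directed from tail j to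
   head j; every undirected edge gets exactly one number and one direction. *)
Definition orientation (N e : nat) (adj : rel 'I_N)
    (tail head : 'I_e -> 'I_N) : Prop :=
  (forall j, adj (tail j) (head j)) /\
  (forall x y, adj x y ->
     exists! j, (tail j = x /\ head j = y) \/ (tail j = y /\ head j = x)).

Definition incidence (R : realType) (N e : nat)
    (tail head : 'I_e -> 'I_N) : 'M[R]_(N, e) :=
  \matrix_(i, j) if i == head j then 1 else if i == tail j then -1 else 0.

Definition laplacian (R : realType) (N e : nat) (B : 'M[R]_(N, e)) : 'M[R]_N :=
  B *m B^T.

(* The real eigenvalues in increasing order, repeated according to their
   (algebraic) multiplicity; polyrcf.rootsR p is the increasing list of the
   distinct real roots of p. *)
Definition eigenvalues (R : realType) (N : nat) (A : 'M[R]_N) : seq R :=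
  flatten [seq nseq (mup x (char_poly A)) x | x <- polyrcf.rootsR (char_poly A)].

(* The second smallest eigenvalue, counted with multiplicity.  For N = 1 there
   is none and the value is 0 by convention. *)
Definition lambda2 (R : realType) (N : nat) (A : 'M[R]_N) : R :=
  nth 0 (eigenvalues A) 1.

Definition kuramoto (R : realType) (N e : nat) (K : R) (B : 'M[R]_(N, e))
    (theta : 'cV[R]_N) : 'cV[R]_N :=
  - (K / N%:R) *: (B *m map_mx (@sin R) (B^T *m theta)).

(* Points of the N-torus (R / 2 pi Z)^N are represented by their real lifts,
   sets of points by their full (2 pi Z^N-invariant) preimages in R^N, and
   curves by continuous real lifts; the lifts of one curve on the torus differ
   by a constant translation as below. *)
Definition shift2pi (R : realType) (N : nat) (k : 'I_N -> int)
    (theta : 'cV[R]_N) : 'cV[R]_N :=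
  \col_i (theta i 0 + 2 * pi * (k i)%:~R).

Definition trajectory (R : realType) (N : nat) (f : 'cV[R]_N -> 'cV[R]_N)
    (theta : R -> 'cV[R]_N) : Prop :=
  {within `[0, +oo[, continuous theta} /\
  (forall t : R, 0 < t -> is_derive t 1 theta (f (theta t))).

Definition equilibria (R : realType) (N : nat) (f : 'cV[R]_N -> 'cV[R]_N) :
  set 'cV[R]_N := [set theta | f theta = 0].

Definition sync_line (R : realType) (N : nat) : set 'cV[R]_N :=
  [set theta | exists theta0 : R, theta = const_mx theta0].

(* All phases equal as angles. *)
Definition sync_state (R : realType) (N : nat) : set 'cV[R]_N :=
  [set theta | exists k : 'I_N -> int, sync_line (shift2pi k theta)].

Definition norm2 (R : realType) (N : nat) (v : 'cV[R]_N) : R :=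
  Num.sqrt (\sum_i v i 0 ^+ 2).

(* When A is 2 pi Z^N-invariant, this is the distance on the torus from the
   point represented by v to the set represented by A. *)
Definition dist (R : realType) (N : nat) (A : set 'cV[R]_N) (v : 'cV[R]_N) : R :=
  inf [set norm2 (v - a) | a in A].

Definition converges_to_set (R : realType) (N : nat)
    (theta : R -> 'cV[R]_N) (A : set 'cV[R]_N) : Prop :=
  dist A (theta t) @[t --> +oo] --> (0 : R).

Definition stable (R : realType) (N : nat) (f : 'cV[R]_N -> 'cV[R]_N)
    (A : set 'cV[R]_N) : Prop :=
  forall eps : R, 0 < eps -> exists2 delta : R, 0 < delta &
    forall theta, trajectory f theta -> dist A (theta 0) < delta ->
    forall t : R, 0 <= t -> dist A (theta t) < eps.

Definition locally_attractive (R : realType) (N : nat)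
    (f : 'cV[R]_N -> 'cV[R]_N) (A : set 'cV[R]_N) : Prop :=
  exists2 delta : R, 0 < delta &
    forall theta, trajectory f theta -> dist A (theta 0) < delta ->
    converges_to_set theta A.

Definition locally_asymptotically_stable (R : realType) (N : nat)
    (f : 'cV[R]_N -> 'cV[R]_N) (A : set 'cV[R]_N) : Prop :=
  stable f A /\ locally_attractive f A.

(* The component orthogonal to the all-ones vector. *)
Definition perp (R : realType) (N : nat) (v : 'cV[R]_N) : 'cV[R]_N :=
  v - const_mx ((\sum_i v i 0) / N%:R).

(* A trajectory starting near the synchronized state has a lift starting near
   the diagonal; it is for this lift that the decay is asserted. *)
Definition sync_rate_at_least (R : realType) (N : nat)
    (f : 'cV[R]_N -> 'cV[R]_N) (c : R) : Prop :=
  exists delta C : R, 0 < delta /\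
    forall theta, trajectory f theta ->
    dist (@sync_state R N) (theta 0) < delta ->
    exists k : 'I_N -> int,
      dist (@sync_line R N) (shift2pi k (theta 0)) < delta /\
      forall t : R, 0 <= t ->
        norm2 (perp (shift2pi k (theta t))) <= C * expR (- (c * t)).

(* Main.v *)
Require Import Defs.
From HB Require Import structures.
From mathcomp Require Import all_boot all_order all_algebra.
From mathcomp Require Import all_classical all_reals all_analysis.
From mathcomp Require Import ring lra.
From mathcomp Require polyrcf.

Set Implicit Arguments.
Unset Strict Implicit.
Unset Printing Implicit Defensive.

Import Order.TTheory GRing.Theory Num.Theory.
Import numFieldNormedType.Exports.

Local Open Scope classical_set_scope.
Local Open Scope ring_scope.

(** Write [x = B^T theta] for the vector of phase differences along the edges.
The field [f] is [- K / N] times the gradient of [F = \sum_j (1 - cos x_j)], so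
[F] decreases along a trajectory at the rate [(N / K) |f theta|^2].

Convergence to equilibria.  [F] is bounded below, so the total dissipation is
finite; since every coordinate of [f theta] is also Lipschitz in time, it cannot
stay away from [0] without wasting a fixed amount of [F] infinitely often, hence
it tends to [0] ([dissipation_cvg0], [kuramoto_coord_cvg0]).  A small field
forces proximity to an equilibrium because the torus is compact: outside an
[eps]-neighbourhood of the equilibria [|f|^2] has a positive minimum
([small_field_near_equilibria]).

Rate near synchrony.  Let [psi] be the component of [theta] orthogonal to the
all-ones vector and [W = |psi|^2].  Then
[W' = - 2 (K / N) \sum_j x_j sin x_j].  As long as [W < 1 / 4] every [x_j] lies
in the interval where Jordan's inequality [x sin x >= (2 / pi) x^2] holds
([mul_sin_ge]), so [W' <= - 2 (2 K / (pi N)) |B^T psi|^2 <= - 2 c W] with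
[c = (2 K / (pi N)) mu], where [mu] is the minimum of the Rayleigh quotient of
[L] over the orthogonal complement of the all-ones vector.  In particular [W]
cannot leave the region [W < 1 / 4] ([sublevel_trapping]), and it decays like
[exp (- 2 c t)] ([sync_decay]).

Spectral input, for at least two vertices.  That minimum is attained, by
compactness of the sphere, at an eigenvector orthogonal to the all-ones vector
([Rayleigh_min_perp]), and it is positive because the graph is connected.  So [0] and [mu] are distinct
eigenvalues of [L] and the second smallest one is at most [mu]
([spectral_gap]). *)

(** * Calculus on the half-line *)

(** The regularity of the coordinates of a [trajectory]: nothing is asked of the
derivative at [0], where continuity from the right suffices for the mean value
theorem on every interval [[a, b]] with [0 <= a]. *)
Definition halfline_deriv (R : realType) (u du : R -> R) : Prop :=
  {within `[0, +oo[, continuous u} /\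
  (forall t : R, 0 < t -> is_derive t 1 u (du t)).

Lemma halfline_deriv_eq (R : realType) (u v du dv : R -> R) :
  (forall t, u t = v t) -> (forall t, du t = dv t) ->
  halfline_deriv u du -> halfline_deriv v dv.
Proof. by move=> /funext -> /funext ->. Qed.

Lemma halfline_deriv_cst (R : realType) (a : R) :
  halfline_deriv (fun=> a) (fun=> 0).
Proof.
split; last by move=> t _; exact: is_derive_cst.
by apply: continuous_subspaceT => x; exact: cst_continuous.
Qed.

Lemma halfline_deriv_id (R : realType) :
  halfline_deriv (fun t : R => t) (fun=> 1).
Proof.
split; last by move=> t _; exact: is_derive_id.
by apply: continuous_subspaceT => x.
Qed.

Lemma halfline_derivD (R : realType) (u v du dv : R -> R) :
  halfline_deriv u du -> halfline_deriv v dv ->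
  halfline_deriv (fun t => u t + v t) (fun t => du t + dv t).
Proof.
move=> [cu hu] [cv hv]; split; first exact: within_continuousD.
move=> t t0; have ? := hu _ t0; have ? := hv _ t0.
exact: is_deriveD.
Qed.

Lemma halfline_derivM (R : realType) (u v du dv : R -> R) :
  halfline_deriv u du -> halfline_deriv v dv ->
  halfline_deriv (fun t => u t * v t) (fun t => u t * dv t + v t * du t).
Proof.
move=> [cu hu] [cv hv]; split.
  by move=> x; apply: cvgM; [exact: cu|exact: cv].
move=> t t0; have ? := hu _ t0; have ? := hv _ t0.
exact: is_deriveM.
Qed.

Lemma halfline_derivZ (R : realType) (a : R) (u du : R -> R) :
  halfline_deriv u du -> halfline_deriv (fun t => a * u t) (fun t => a * du t).
Proof.
move=> hu; have := halfline_derivM (halfline_deriv_cst a) hu.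
by congr (halfline_deriv _); apply/funext => t; rewrite mulr0 addr0.
Qed.

Lemma halfline_deriv_sum (R : realType) (I : finType) (u du : I -> R -> R) :
  (forall i, halfline_deriv (u i) (du i)) ->
  halfline_deriv (fun t => \sum_i u i t) (fun t => \sum_i du i t).
Proof.
move=> h; elim: (index_enum I) => [|i s IH].
  have nilE (w : I -> R -> R) : (fun t => \sum_(i <- [::]) w i t) = (fun=> 0).
    by apply/funext => t; rewrite big_nil.
  by rewrite !nilE; exact: halfline_deriv_cst.
have consE (w : I -> R -> R) : (fun t => \sum_(j <- i :: s) w j t) =
    (fun t => w i t + \sum_(j <- s) w j t).
  by apply/funext => t; rewrite big_cons.
by rewrite !consE; exact: halfline_derivD.
Qed.

Lemma halfline_deriv_comp (R : realType) (g dg u du : R -> R) :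
  (forall x : R, is_derive x 1 g (dg x)) -> halfline_deriv u du ->
  halfline_deriv (fun t => g (u t)) (fun t => dg (u t) * du t).
Proof.
move=> hg [cu hu]; split.
  apply: (@within_continuous_comp _ _ _ _ u g) => // x _.
  apply: differentiable_continuous; apply/derivable1_diffP.
  by have [] := hg x.
move=> t t0; have ? := hu _ t0; have ? := hg (u t).
exact: (@is_derive1_comp _ g u).
Qed.

Lemma halfline_deriv_MVT (R : realType) (u du : R -> R) (a b : R) :
  halfline_deriv u du -> 0 <= a -> a < b ->
  exists c, [/\ a < c, c < b & u b - u a = du c * (b - a)].
Proof.
move=> [cu hu] a0 ab.
have [||c] := @MVT R u du a b ab.
- move=> x; rewrite in_itv/= => /andP[ax _]; apply: hu; exact: le_lt_trans ax.
- apply: continuous_subspaceW cu => x /=; rewrite !in_itv/= => /andP[ax _].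
  by rewrite andbT (le_trans a0).
by rewrite in_itv/= => /andP[ac cb] e; exists c.
Qed.

Lemma halfline_deriv_nincr (R : realType) (u du : R -> R) :
  halfline_deriv u du -> (forall t, 0 < t -> du t <= 0) ->
  forall a b, 0 <= a -> a <= b -> u b <= u a.
Proof.
move=> hu du0 a b a0; rewrite le_eqVlt => /predU1P[->//|ab].
have [c [ac _ e]] := halfline_deriv_MVT hu a0 ab.
rewrite -subr_le0 e mulr_le0_ge0 ?subr_ge0 ?(ltW ab)//.
by apply: du0; exact: le_lt_trans ac.
Qed.

Lemma halfline_deriv_Lipschitz (R : realType) (M : R) (u du : R -> R) :
  halfline_deriv u du -> (forall t, 0 < t -> `|du t| <= M) ->
  forall a b, 0 <= a -> a <= b -> `|u b - u a| <= M * (b - a).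
Proof.
move=> hu duM a b a0; rewrite le_eqVlt => /predU1P[->|ab].
  by rewrite !subrr normr0 mulr0.
have [c [ac _ ->]] := halfline_deriv_MVT hu a0 ab.
rewrite normrM (gtr0_norm (_ : 0 < b - a)) ?subr_gt0//.
rewrite ler_wpM2r ?subr_ge0 ?(ltW ab)//.
by apply: duM; exact: le_lt_trans ac.
Qed.

(** Let [s] be the infimum of the times where [W >= r].  Before [s], [W < r] and
hence [W' <= 0], so the mean value theorem gives [W s <= W 0 < r]; by continuity
[W < r] still holds shortly after [s], against the choice of [s]. *)
Lemma sublevel_trapping (R : realType) (r : R) (W dW : R -> R) :
  halfline_deriv W dW -> (forall t, 0 < t -> W t < r -> dW t <= 0) ->
  W 0 < r -> forall t, 0 <= t -> W t < r.
Proof.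
move=> hW dW0 W0r T T0; rewrite ltNge; apply/negP => rT.
pose S := [set t : R | 0 <= t /\ r <= W t].
have infS : has_inf S.
  by split; [exists T|exists 0 => t []].
pose s := inf S.
have s0 : 0 <= s by apply: lb_le_inf; [exists T|move=> t []].
have before t : 0 <= t -> t < s -> W t < r.
  move=> t0 ts; rewrite ltNge; apply/negP => rt.
  by have := lt_le_trans ts (ge_inf infS.2 (conj t0 rt)); rewrite ltxx.
have Ws : W s < r.
  move: s0; rewrite le_eqVlt => /predU1P[<-//|s0].
  have [c [c0 cs e]] := halfline_deriv_MVT hW (lexx 0) s0.
  apply: le_lt_trans W0r; rewrite -subr_le0 e subr0 mulr_le0_ge0 ?(ltW s0)//.
  by apply: dW0 => //; apply: before => //; exact: ltW.
have [cW _] := hW.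
have := (subspace_continuousP _ _).1 cW s.
rewrite /= in_itv/= s0 => /(_ isT)/cvgrPdist_lt/(_ (r - W s)).
rewrite subr_gt0 => /(_ Ws); rewrite near_withinE => -[d /= d0 hd].
have [t [t0 rt] tsd] := inf_adherent d0 infS.
have st : s <= t by apply: ge_inf => //; exact: infS.2.
have := hd t; rewrite /= in_itv/= t0 => /(_ _ isT).
rewrite distrC ger0_norm ?subr_ge0// ltrBlDr addrC => /(_ tsd).
apply/negP; rewrite -leNgt distrC.
by rewrite (le_trans _ (ler_norm _))// lerD2r.
Qed.

(** The function [W t * exp (a t)] is nonincreasing. *)
Lemma Gronwall_decay (R : realType) (a : R) (W dW : R -> R) :
  halfline_deriv W dW -> (forall t, 0 < t -> dW t <= - (a * W t)) ->
  forall t, 0 <= t -> W t <= W 0 * expR (- (a * t)).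
Proof.
move=> hW dWle t t0.
have hexp := halfline_deriv_comp (@is_derive_expR R)
  (halfline_derivZ a (@halfline_deriv_id R)).
have := halfline_deriv_nincr (halfline_derivM hW hexp) _ (lexx 0) t0.
rewrite mulr0 expR0 !mulr1 expRN ler_pdivlMr ?expR_gt0//; apply => s s0.
rewrite mulrCA -mulrDr pmulr_rle0 ?expR_gt0//.
by rewrite addrC mulrC -lerBrDr sub0r; exact: dWle.
Qed.

(** A form of Barbalat's lemma for a dissipated quantity.  On a window of fixed
length [h] the mean value theorem produces a time [c] with
[k * u c ^ 2 * h] at most the loss of [F] over the window, which tends to [0]
as [F] decreases to its infimum; the Lipschitz bound carries the smallness of
[u c] over to the whole window. *)
Lemma dissipation_cvg0 (R : realType) (k L : R) (F dF u : R -> R) :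
  0 < k -> 0 <= L -> halfline_deriv F dF -> (forall t, 0 <= F t) ->
  (forall t, 0 < t -> dF t <= - (k * u t ^+ 2)) ->
  (forall a b, 0 <= a -> a <= b -> `|u b - u a| <= L * (b - a)) ->
  u t @[t --> +oo] --> (0 : R).
Proof.
move=> k0 L0 hF F0 dFle uL; apply/cvgr0Pnorm_lt => eps eps0.
have eps20 : 0 < eps / 2 by rewrite divr_gt0.
pose h := eps / 2 / (L + 1).
have L10 : 0 < L + 1 by rewrite ltr_wpDl.
have h0 : 0 < h by rewrite divr_gt0.
have Lh : L * h < eps / 2.
  by rewrite mulrCA gtr_pMr// ltr_pdivrMr// mul1r ltrDl.
pose S := [set F t | t in [set t : R | 0 <= t]].
have infS : has_inf S.
  by split; [exists (F 0), 0 => //=|exists 0 => _ [t _ <-]].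
have eta0 : 0 < k * (eps / 2) ^+ 2 * h.
  by apply: mulr_gt0 => //; apply: mulr_gt0 => //; exact: exprn_gt0.
have [_ [T /= T0 <-] FT] := inf_adherent eta0 infS.
have dF0 t : 0 < t -> dF t <= 0.
  move=> t0; apply: le_trans (dFle _ t0) _.
  by rewrite oppr_le0 mulr_ge0 ?sqr_ge0 ?(ltW k0).
exists T; split; first exact: num_real.
move=> t /ltW Tt; have t0 := le_trans T0 Tt.
have tth : t < t + h by rewrite ltrDl.
have [c [tc cth e]] := halfline_deriv_MVT hF t0 tth.
have c0 : 0 < c by exact: le_lt_trans tc.
have uc : `|u c| < eps / 2.
  rewrite -(ltr_pXn2r (_ : 0 < 2)%N) ?nnegrE// ?(ltW eps20)//.
  rewrite real_normK ?num_real// -(ltr_pM2l k0) -(ltr_pM2r h0).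
  have : inf S <= F (t + h).
    apply: ge_inf; first exact: infS.2.
    by exists (t + h) => //=; exact: ltW (le_lt_trans t0 tth).
  have : F t <= F T by exact: (halfline_deriv_nincr hF dF0).
  have : F (t + h) - F t <= - (k * u c ^+ 2) * h.
    by rewrite e addrAC subrr add0r ler_wpM2r ?(ltW h0)//; exact: dFle.
  move: FT; rewrite mulNr; lra.
have := uL t c t0 (ltW tc).
have : L * (c - t) <= L * h by rewrite ler_wpM2l// lerBlDl ltW.
have := ler_normB (u c) (u c - u t); rewrite opprB addrC subrK.
lra.
Qed.

Lemma expR_decay_cvg0 (R : realType) (c : R) : 0 < c ->
  expR (- (c * t)) @[t --> +oo] --> (0 : R).
Proof.
move=> c0; apply/cvgr0Pnorm_lt => eps eps0.
exists (eps^-1 / c); split; first exact: num_real.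
move=> t; rewrite ltr_pdivrMr// => ht.
rewrite ger0_norm ?expR_ge0// expRN -[ltRHS]invrK.
rewrite ltf_pV2 ?posrE ?invr_gt0 ?expR_gt0//.
apply: lt_le_trans (expR_ge1Dx _); rewrite mulrC; lra.
Qed.

(** * Inequalities and periodicity for the sine *)

(** The graph of sine lies above its chord on [[0, pi / 2]].  If it passed below
the chord at [x], its slope would be less than that of the chord somewhere in
[[0, x]] and greater somewhere in [[x, pi / 2]], but the cosine decreases. *)
Lemma jordan_sin (R : realType) (x : R) : 0 <= x -> x <= pi / 2 ->
  2 / pi * x <= sin x.
Proof.
move=> x0 xpi; rewrite leNgt; apply/negP => sx.
have pi0 : 0 < pi :> R := pi_gt0 R.
have pi20 : 0 < pi / 2 :> R by rewrite divr_gt0.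
have hsin : halfline_deriv (@sin R) (fun y => cos y * 1).
  exact: (halfline_deriv_comp (@is_derive_sin R) (@halfline_deriv_id R)).
have [xz|xz] := eqVneq x 0; first by move: sx; rewrite xz sin0 mulr0 ltxx.
have {xz}x0 : 0 < x by rewrite lt_neqAle eq_sym xz.
have [xe|xz] := eqVneq x (pi / 2).
  move: sx; rewrite xe sin_pihalf mulrA divfK ?gt_eqF//.
  by rewrite divff ?ltxx// pnatr_eq0.
have {xz xpi}xpi : x < pi / 2 by rewrite lt_neqAle xz.
have [c [c0 cx ec]] := halfline_deriv_MVT hsin (lexx 0) x0.
have [d [xd dpi ed]] := halfline_deriv_MVT hsin (ltW x0) xpi.
move: ec ed; rewrite sin0 sin_pihalf !mulr1 !subr0 => ec ed.
have cle : cos d < cos c.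
  rewrite ltr_cos ?(lt_trans cx)// in_itv/=; apply/andP; split; lra.
have : cos c < 2 / pi by rewrite -(ltr_pM2r x0) -ec.
have : 2 / pi < cos d.
  rewrite -(ltr_pM2r (_ : 0 < pi / 2 - x)) ?subr_gt0// -ed mulrBr.
  have -> : 2 / pi * (pi / 2) = 1 :> R by rewrite mulrA divfK ?gt_eqF// divff.
  by rewrite ltrD2l ltrN2.
by move=> h1 h2; have := lt_trans h2 (lt_trans h1 cle); rewrite ltxx.
Qed.

Lemma mul_sin_ge (R : realType) (x : R) : `|x| <= pi / 2 ->
  2 / pi * x ^+ 2 <= x * sin x.
Proof.
have nonneg (y : R) : 0 <= y -> y <= pi / 2 -> 2 / pi * y ^+ 2 <= y * sin y.
  move=> y0 ypi; rewrite expr2 mulrA [leRHS]mulrC ler_wpM2r//.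
  exact: jordan_sin.
have [x0|/ltW x0] := leP 0 x; first by rewrite ger0_norm//; exact: nonneg.
rewrite -normrN => xpi; have := nonneg (- x); rewrite oppr_ge0 => /(_ x0).
rewrite sinN mulrNN sqrrN; apply; apply: le_trans xpi; exact: ler_norm.
Qed.

Lemma sin_period_int (R : realType) (x : R) (z : int) :
  sin (x + 2 * pi * z%:~R) = sin x.
Proof.
have sinn (y : R) k : sin (y + 2 * pi * k%:R) = sin y.
  have -> : 2 * pi * k%:R = pi *+ 2 *+ k :> R.
    by rewrite -(mulr_natr (pi *+ 2)) -(mulr_natl pi).
  exact: (periodicn (@sinD2pi R)).
case: z => k; first exact: sinn.
rewrite NegzE -[in RHS](subrK (2 * pi * k.+1%:R) x) sinn.
by rewrite rmorphN/= mulrN.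
Qed.

(** * Quadratic forms and Rayleigh quotients *)

Definition dot (R : realType) (n : nat) (u v : 'cV[R]_n) : R :=
  \sum_i u i 0 * v i 0.

Lemma dotC (R : realType) (n : nat) (u v : 'cV[R]_n) : dot u v = dot v u.
Proof. by apply: eq_bigr => i _; rewrite mulrC. Qed.

Lemma dotDl (R : realType) (n : nat) (u v w : 'cV[R]_n) :
  dot (u + v) w = dot u w + dot v w.
Proof. by rewrite -big_split/=; apply: eq_bigr => i _; rewrite mxE mulrDl. Qed.

Lemma dotZl (R : realType) (n : nat) (a : R) (u w : 'cV[R]_n) :
  dot (a *: u) w = a * dot u w.
Proof. by rewrite mulr_sumr; apply: eq_bigr => i _; rewrite mxE mulrA. Qed.

Lemma dotDr (R : realType) (n : nat) (u v w : 'cV[R]_n) :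
  dot w (u + v) = dot w u + dot w v.
Proof. by rewrite dotC dotDl !(dotC w). Qed.

Lemma dotZr (R : realType) (n : nat) (a : R) (u w : 'cV[R]_n) :
  dot w (a *: u) = a * dot w u.
Proof. by rewrite dotC dotZl dotC. Qed.

Lemma dot_mulmxl (R : realType) (m n : nat) (A : 'M[R]_(m, n)) u v :
  dot (A *m u) v = dot u (A^T *m v).
Proof.
rewrite /dot; under eq_bigr do rewrite mxE mulr_suml.
rewrite exchange_big/=; apply: eq_bigr => j _.
by rewrite mxE mulr_sumr; apply: eq_bigr => i _; rewrite mxE mulrA (mulrC (u j 0)).
Qed.

Lemma dot_ge0 (R : realType) (n : nat) (u : 'cV[R]_n) : 0 <= dot u u.
Proof. by apply: sumr_ge0 => i _; rewrite -expr2 sqr_ge0. Qed.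

Lemma dot_coord_le (R : realType) (n : nat) (u : 'cV[R]_n) i :
  u i 0 ^+ 2 <= dot u u.
Proof.
rewrite /dot (bigD1 i)//= -expr2 lerDl.
by apply: sumr_ge0 => j _; rewrite -expr2 sqr_ge0.
Qed.

Lemma dot_eq0 (R : realType) (n : nat) (u : 'cV[R]_n) : dot u u = 0 -> u = 0.
Proof.
move=> u0; apply/matrixP => i j; rewrite ord1 mxE; apply/eqP.
by rewrite -sqrf_eq0 eq_le sqr_ge0 andbT -[leRHS]u0 dot_coord_le.
Qed.

Lemma continuous_dot (R : realType) (T : topologicalType) (n : nat)
    (F G : T -> 'cV[R]_n) :
  (forall i, continuous (fun x => F x i 0)) ->
  (forall i, continuous (fun x => G x i 0)) ->
  continuous (fun x => dot (F x) (G x)).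
Proof.
move=> cF cG; rewrite /dot; apply: continuous_big => [|i _ x].
  exact: add_continuous.
by apply: cvgM; [exact: cF|exact: cG].
Qed.

Lemma continuous_mulmx_coord (R : realType) (T : topologicalType) (m n : nat)
    (A : 'M[R]_(m, n)) (F : T -> 'cV[R]_n) :
  (forall i, continuous (fun x => F x i 0)) ->
  forall i, continuous (fun x => (A *m F x) i 0).
Proof.
move=> cF i.
have -> : (fun x => (A *m F x) i 0) = (fun x => dot (row i A)^T (F x)).
  by apply/funext => x; rewrite mxE; apply: eq_bigr => j _; rewrite !mxE.
by apply: continuous_dot => // j x; exact: cst_continuous.
Qed.

Lemma continuous_tr_coord (R : realType) (n : nat) (i : 'I_n) :
  continuous (fun v : 'rV[R]_n => v^T i 0).
Proof.
have -> : (fun v : 'rV[R]_n => v^T i 0) = (fun v => v 0 i).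
  by apply/funext => v; rewrite mxE.
exact: coord_continuous.
Qed.

(** Here [2 * d] is the first-order coefficient at a minimum: a positive [d]
would make the value negative for small negative [t]. *)
Lemma first_order_min (R : realType) (d C : R) :
  0 <= d -> (forall t, 0 <= t * (2 * d + t * C)) -> d = 0.
Proof.
move=> d0 h; apply/eqP; rewrite eq_le d0 andbT leNgt; apply/negP => {}d0.
have C1 : 0 < `|C| + 1 by rewrite ltr_wpDl.
pose s := d / (`|C| + 1); have s0 : 0 < s by rewrite divr_gt0.
have := h (- s); rewrite mulNr oppr_ge0 pmulr_rle0// mulNr subr_le0 => h1.
have : s * C < d.
  rewrite /s mulrAC ltr_pdivrMr// ltr_pM2l//.
  by rewrite (le_lt_trans (ler_norm _))// ltrDl.
lra.
Qed.

(** The minimiser [u] of the quadratic form on the unit sphere of the complement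
of [w0] is an eigenvector: the residual [z = A u - mu u] is itself orthogonal
to [w0], so it is an admissible direction of perturbation, and minimality along
[u + t z] leaves a first-order term [2 t |z|^2] that has to vanish. *)
Lemma Rayleigh_min_perp (R : realType) (n : nat) (A : 'M[R]_n)
    (w0 : 'cV[R]_n) (c : R) :
  A^T = A -> A *m w0 = c *: w0 ->
  (exists2 v, v != 0 & dot v w0 = 0) ->
  exists u mu, [/\ u != 0, dot u w0 = 0, A *m u = mu *: u &
    forall w, dot w w0 = 0 -> mu * dot w w <= dot w (A *m w)].
Proof.
move=> Asym Aw0 [v v0 vw0].
have normalize (w : 'cV[R]_n) : w != 0 -> dot w w0 = 0 ->
    exists2 a : R, 0 < a & dot w w = a ^+ 2 /\
      dot (a^-1 *: w) (a^-1 *: w) = 1 /\ dot (a^-1 *: w) w0 = 0.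
  move=> wn0 ww0; have ww : 0 < dot w w.
    rewrite lt_neqAle dot_ge0 andbT eq_sym.
    by apply/eqP => /dot_eq0/eqP; apply/negP.
  exists (Num.sqrt (dot w w)); first by rewrite sqrtr_gt0.
  rewrite sqr_sqrtr ?dot_ge0//; split => //; split.
    rewrite dotZl dotZr mulrA -invfM -expr2 sqr_sqrtr ?dot_ge0//.
    by rewrite mulVf// gt_eqF.
  by rewrite dotZl ww0 mulr0.
pose S := [set x : 'rV[R]_n | dot x^T x^T = 1 /\ dot x^T w0 = 0].
have ctr := @continuous_tr_coord R n.
have cdd : continuous (fun x : 'rV[R]_n => dot x^T x^T) by exact: continuous_dot.
have cdw : continuous (fun x : 'rV[R]_n => dot x^T w0).
  by apply: continuous_dot => // i x; exact: cst_continuous.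
have cq : continuous (fun x : 'rV[R]_n => dot x^T (A *m x^T)).
  by apply: continuous_dot => //; exact: continuous_mulmx_coord.
have Sne : S !=set0.
  have [a _ [_ [h1 h2]]] := normalize _ v0 vw0.
  by exists (a^-1 *: v)^T; rewrite /S /= trmxK.
have Sclosed : closed S.
  have -> : S = (fun x : 'rV[R]_n => dot x^T x^T) @^-1` [set 1] `&`
               (fun x : 'rV[R]_n => dot x^T w0) @^-1` [set 0] by [].
  apply: closedI; apply: preimage_closed; try exact: closed_eq.
    by move=> x _; exact: cdd.
  by move=> x _; exact: cdw.
have Sbounded : bounded_set S.
  exists 1; split; first exact: num_real.
  move=> M M1 x [x1 _]; apply: le_trans (ltW M1).
  rewrite /Num.Def.normr/= mx_normrE; apply: bigmax_le => // -[i j] _ /=.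
  rewrite -(@ler_pXn2r _ 2)// ?nnegrE// expr1n real_normK ?num_real// -x1.
  by have := dot_coord_le x^T j; rewrite mxE (ord1 i).
have [x0 /set_mem[x01 x0w] xmin] := EVT_min_rV Sne
  (bounded_closed_compact Sbounded Sclosed) (continuous_subspaceT cq).
pose u := x0^T; pose mu := dot u (A *m u).
have minw w : dot w w0 = 0 -> mu * dot w w <= dot w (A *m w).
  move=> ww0; have [->|wn0] := eqVneq w 0.
    by rewrite mulmx0 -(scale0r (0 : 'cV[R]_n)) !dotZl !mul0r mulr0.
  have [a a0 [-> [h1 h2]]] := normalize _ wn0 ww0.
  have := xmin (a^-1 *: w)^T; rewrite trmxK => /(_ _)/[!inE].
  rewrite /S/= trmxK => /(_ (conj h1 h2)).
  rewrite -scalemxAr dotZl dotZr mulrA -expr2 exprVn ler_pdivlMl ?exprn_gt0//.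
  by rewrite mulrC.
exists u, mu; split => //.
- apply/eqP => u0; move: x01; rewrite -/u u0 -(scale0r (0 : 'cV[R]_n)) dotZl.
  by rewrite mul0r => /esym/eqP; rewrite oner_eq0.
pose z := A *m u - mu *: u.
have zw : dot z w0 = 0.
  rewrite dotDl dot_mulmxl Asym Aw0 dotZr x0w -scaleNr dotZl x0w.
  by rewrite !mulr0 addr0.
apply/eqP; rewrite -subr_eq0 -/z; apply/eqP/dot_eq0.
have zz : dot z z = dot (A *m u) z - mu * dot u z.
  by rewrite {1}/z dotDl -scaleNr dotZl mulNr.
clearbody z.
(* Expand the minimality of [mu] at [u + t z] to first order in [t]. *)
apply: (first_order_min (C := dot z (A *m z) - mu * dot z z)) (dot_ge0 z) _.
move=> t; have : dot (u + t *: z) w0 = 0.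
  by rewrite dotDl dotZl zw x0w mulr0 addr0.
move=> /minw; rewrite mulmxDr -scalemxAr.
have e1 : dot u (A *m z) = dot (A *m u) z by rewrite dot_mulmxl Asym.
rewrite !(dotDl, dotDr, dotZl, dotZr) -/mu x01 (dotC z u) (dotC z (A *m u)) e1.
by rewrite -subr_ge0 zz; congr (0 <= _); ring.
Qed.

(** * The Laplacian spectrum of a connected graph *)

Lemma sorted_flatten_nseq (R : realType) (m : R -> nat) (r : seq R) :
  sorted <%R r -> sorted <=%R (flatten [seq nseq (m x) x | x <- r]).
Proof.
rewrite (sorted_pairwise lt_trans) (sorted_pairwise le_trans).
elim: r => //= x r IH /andP[/allP xr rr].
rewrite pairwise_cat IH// andbT; apply/andP; split; last first.
  by elim: (m x) => //= k ->; rewrite andbT; apply/allP => y /nseqP[->].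
apply/allrelP => y z /nseqP[-> _] /flatten_mapP[t tr /nseqP[-> _]].
exact/ltW/xr.
Qed.

Lemma mem_eigenvalues (R : realType) (n : nat) (A : 'M[R]_n) (a : R) :
  eigenvalue A a -> a \in eigenvalues A.
Proof.
have p0 : char_poly A != 0 by exact/monic_neq0/char_poly_monic.
rewrite eigenvalue_root_char => ra; apply/flatten_mapP; exists a.
  by rewrite -(polyrcf.roots_on_rootsR p0) ra andbT in_itv.
by rewrite mem_nseq eqxx andbT -XsubC_dvd// dvdp_XsubCl.
Qed.

(** In the sorted list of eigenvalues [b] has the entry [a] before it, so its
index is at least [1]. *)
Lemma lambda2_le (R : realType) (n : nat) (A : 'M[R]_n) (a b : R) :
  a < b -> eigenvalue A a -> eigenvalue A b -> lambda2 A <= b.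
Proof.
move=> ab /mem_eigenvalues ha /mem_eigenvalues hb; rewrite /lambda2.
have : sorted <=%R (eigenvalues A).
  exact/sorted_flatten_nseq/polyrcf.sorted_roots.
move: (eigenvalues A) ha hb => s ha hb ss.
have mono := sorted_leq_nth le_trans lexx 0 ss.
have ib : (index b s < size s)%N by rewrite index_mem.
have i1 : (0 < index b s)%N.
  rewrite lt0n; apply/eqP => b0.
  have := mono (index b s) (index a s).
  rewrite !inE !index_mem ha hb b0 !nth_index// => /(_ isT isT isT).
  by rewrite -b0 nth_index// leNgt ab.
rewrite -[leRHS](nth_index 0 hb); apply: mono => //; rewrite inE//.
exact: leq_ltn_trans ib.
Qed.

Lemma incidence_tr_coord (R : realType) (N e : nat) (adj : rel 'I_N)
    (tail head : 'I_e -> 'I_N) (u : 'cV[R]_N) (j : 'I_e) :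
  simple_graph adj -> orientation adj tail head ->
  ((incidence R tail head)^T *m u) j 0 = u (head j) 0 - u (tail j) 0.
Proof.
move=> [_ irr] [or _].
have ht : tail j != head j by apply/eqP => ht; have := or j; rewrite ht irr.
rewrite mxE (bigD1 (head j))//= (bigD1 (tail j))//= big1 => [|i /andP[ih it]].
  by rewrite !mxE !eqxx (negbTE ht) addr0 mul1r mulN1r.
by rewrite !mxE (negbTE ih) (negbTE it) mul0r.
Qed.

Lemma incidence_coord_le1 (R : realType) (N e : nat)
    (tail head : 'I_e -> 'I_N) i j :
  `|incidence R tail head i j| <= 1.
Proof.
by rewrite mxE; case: ifP => _; [|case: ifP => _];
  rewrite ?normrN ?normr1 ?normr0.
Qed.

Lemma incidence_tr_const (R : realType) (N e : nat) (adj : rel 'I_N)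
    (tail head : 'I_e -> 'I_N) (a : R) :
  simple_graph adj -> orientation adj tail head ->
  (incidence R tail head)^T *m const_mx a = 0 :> 'cV_e.
Proof.
move=> hs ho; apply/matrixP => j k.
by rewrite ord1 (incidence_tr_coord _ _ hs ho) !mxE subrr.
Qed.

(** Along an edge the two end values agree, and any two vertices are joined by
a path. *)
Lemma incidence_tr_ker (R : realType) (N e : nat) (adj : rel 'I_N)
    (tail head : 'I_e -> 'I_N) (u : 'cV[R]_N) :
  simple_graph adj -> connected_graph adj -> orientation adj tail head ->
  (incidence R tail head)^T *m u = 0 -> forall x y, u x 0 = u y 0.
Proof.
move=> hs hc ho u0 x y; have /connectP[p] := hc x y.
elim: p x => [x _ ->//|z p IH x /= /andP[xz zp] yl].
rewrite -(IH z)//; have [j [hj _]] := ho.2 x z xz.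
have /eqP := incidence_tr_coord u j hs ho.
by rewrite u0 mxE eq_sym subr_eq0 => /eqP; case: hj => -[-> ->].
Qed.

(** The gap [mu] is the minimal Rayleigh quotient of the Laplacian on the
complement of the all-ones vector; it exceeds [0] by connectedness.  When that
complement is zero (one vertex) any positive number above [lambda2] will do. *)
Lemma spectral_gap (R : realType) (N e : nat) (adj : rel 'I_N)
    (tail head : 'I_e -> 'I_N) :
  simple_graph adj -> connected_graph adj -> orientation adj tail head ->
  let B := incidence R tail head in
  exists mu : R, [/\ 0 < mu, lambda2 (laplacian B) <= mu &
    forall w, dot w (const_mx 1) = 0 ->
      mu * dot w w <= dot (B^T *m w) (B^T *m w)].
Proof.
move=> hs hc ho B; pose L := laplacian B.
have [w0ex|w0nex] :=
    pselect (exists2 w : 'cV[R]_N, w != 0 & dot w (const_mx 1) = 0); last first.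
  exists (Num.max 1 (lambda2 L)).
  split; rewrite ?lt_max ?ltr01 ?le_max ?lexx ?orbT//.
  move=> w w1; have [->|w0] := eqVneq w 0; last by case: w0nex; exists w.
  by rewrite mulmx0 -(scale0r (0 : 'cV[R]_N)) dotZl mul0r mulr0 dot_ge0.
have Lsym : L^T = L by rewrite /L /laplacian trmx_mul trmxK.
have L1 : L *m const_mx 1 = 0 *: const_mx 1 :> 'cV_N.
  by rewrite -mulmxA (incidence_tr_const _ hs ho) mulmx0 scale0r.
have qL (w : 'cV[R]_N) : dot (B^T *m w) (B^T *m w) = dot w (L *m w).
  by rewrite dot_mulmxl trmxK mulmxA.
have [u [mu [u0 u1 Lu umin]]] := Rayleigh_min_perp Lsym L1 w0ex.
have uu : 0 < dot u u.
  by rewrite lt_neqAle dot_ge0 andbT eq_sym; apply/eqP => /dot_eq0/eqP; apply/negP.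
have mu0 : 0 < mu.
  rewrite -(pmulr_lgt0 _ uu) -dotZr -Lu -qL lt_neqAle dot_ge0 andbT eq_sym.
  apply/eqP => /dot_eq0 /(incidence_tr_ker hs hc ho) ucst.
  move/eqP: u0; apply; apply/matrixP => i k.
  have uE : dot u u = dot u (const_mx 1) * u i 0.
    by rewrite mulr_suml; apply: eq_bigr => l _; rewrite mxE mulr1 (ucst l i).
  by move: uu; rewrite uE u1 mul0r ltxx.
exists mu; split => // [|w w1]; last by rewrite qL umin.
have eig (v : 'cV[R]_N) a : v != 0 -> L *m v = a *: v -> eigenvalue L a.
  move=> v0 Lv; apply/eigenvalueP; exists v^T; last by rewrite trmx_eq0.
  by rewrite -[in LHS]Lsym -trmx_mul Lv linearZ.
apply: (lambda2_le mu0); apply: eig; [|exact: L1|exact: u0|exact: Lu].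
apply: contra_neq u0 => one0; apply: dot_eq0.
have -> : dot u u = \sum_i u i 0 * (const_mx 1 : 'cV[R]_N) i 0 * u i 0.
  by apply: eq_bigr => i _; rewrite mxE mulr1.
by apply: big1 => i _; rewrite one0 mxE mulr0 mul0r.
Qed.

(** * Distances on the torus *)

Lemma norm2E (R : realType) (n : nat) (v : 'cV[R]_n) :
  norm2 v = Num.sqrt (dot v v).
Proof. by []. Qed.

Lemma norm2_ge0 (R : realType) (n : nat) (v : 'cV[R]_n) : 0 <= norm2 v.
Proof. exact: sqrtr_ge0. Qed.

Lemma dist_le (R : realType) (n : nat) (A : set 'cV[R]_n) (v a : 'cV[R]_n) :
  A a -> dist A v <= norm2 (v - a).
Proof.
move=> Aa; apply: ge_inf; last by exists a.
by exists 0 => _ [b _ <-]; exact: norm2_ge0.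
Qed.

Lemma dist_ge0 (R : realType) (n : nat) (A : set 'cV[R]_n) (v : 'cV[R]_n) :
  A !=set0 -> 0 <= dist A v.
Proof.
move=> [a Aa]; apply: lb_le_inf; first by exists (norm2 (v - a)), a.
by move=> _ [b _ <-]; exact: norm2_ge0.
Qed.

Lemma dist_lt (R : realType) (n : nat) (A : set 'cV[R]_n) (v : 'cV[R]_n)
    (d : R) :
  A !=set0 -> dist A v < d -> exists2 a, A a & norm2 (v - a) < d.
Proof.
move=> [a Aa] dv.
have hi : has_inf [set norm2 (v - b) | b in A].
  split; first by exists (norm2 (v - a)), a.
  by exists 0 => _ [b _ <-]; exact: norm2_ge0.
have d0 : 0 < d - dist A v by rewrite subr_gt0.
have [_ [b Ab <-]] := inf_adherent d0 hi.
by rewrite -/(dist A v) [ltRHS]addrC subrK => ?; exists b.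
Qed.

Lemma dot_perp_const (R : realType) (n : nat) (v : 'cV[R]_n) :
  (0 < n)%N -> dot (perp v) (const_mx 1) = 0.
Proof.
move=> n0; rewrite /dot; under eq_bigr do rewrite !mxE mulr1.
rewrite sumrB sumr_const card_ord -[X in _ - X]mulr_natr divfK ?subrr//.
by rewrite pnatr_eq0 -lt0n.
Qed.

Lemma dot_perp_perp (R : realType) (n : nat) (u v : 'cV[R]_n) :
  (0 < n)%N -> dot (perp u) (perp v) = dot (perp u) v.
Proof.
move=> n0; rewrite {2}/perp.
have -> : const_mx ((\sum_i v i 0) / n%:R) =
    ((\sum_i v i 0) / n%:R) *: const_mx 1 :> 'cV[R]_n.
  by apply/matrixP => i j; rewrite !mxE mulr1.
by rewrite -scaleNr dotDr dotZr dot_perp_const// mulr0 addr0.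
Qed.

(** Pythagoras: [v - a] differs from [perp v] by a multiple of the all-ones
vector, to which [perp v] is orthogonal. *)
Lemma norm2_perp_le (R : realType) (n : nat) (v a : 'cV[R]_n) :
  (0 < n)%N -> sync_line a -> norm2 (perp v) <= norm2 (v - a).
Proof.
move=> n0 [c ->]; rewrite !norm2E ler_sqrt ?dot_ge0//.
have -> : v - const_mx c =
    perp v + ((\sum_i v i 0) / n%:R - c) *: const_mx 1.
  by apply/matrixP => i j; rewrite !mxE; ring.
move: (perp v) (dot_perp_const v n0) => p p1.
rewrite !(dotDl, dotDr, dotZl, dotZr) (dotC (const_mx 1)) p1.
by rewrite !mulr0 addr0 add0r lerDl mulrA mulr_ge0 ?dot_ge0// -expr2 sqr_ge0.
Qed.

Lemma shift2piB (R : realType) (n : nat) (k : 'I_n -> int)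
    (u v : 'cV[R]_n) : shift2pi k u - shift2pi k v = u - v.
Proof. by apply/matrixP => i j; rewrite !mxE !ord1; ring. Qed.

Lemma shift2piK (R : realType) (n : nat) (k : 'I_n -> int) :
  cancel (@shift2pi R n (fun i => - k i)) (shift2pi k).
Proof.
by move=> v; apply/matrixP => i j; rewrite !mxE !ord1 rmorphN/=; ring.
Qed.

Lemma shift2pi_cube (R : realType) (n : nat) (v : 'cV[R]_n) :
  exists k : 'I_n -> int, forall i, 0 <= shift2pi k v i 0 <= 2 * pi.
Proof.
have pi0 : 0 < 2 * pi :> R by rewrite mulr_gt0// pi_gt0.
exists (fun i => - Num.floor (v i 0 / (2 * pi))) => i; rewrite mxE rmorphN/=.
have := floor_itv (v i 0 / (2 * pi)).
rewrite ler_pdivlMr// ltr_pdivrMr// => /andP[].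
rewrite rmorphD/= => h1 h2; apply/andP; split; lra.
Qed.

Lemma sync_state_neq0 (R : realType) (n : nat) : @sync_state R n !=set0.
Proof.
exists 0; exists (fun=> 0), 0; apply/matrixP => i j.
by rewrite !mxE mulr0 addr0.
Qed.

Lemma dist_sync_state_le (R : realType) (n : nat) (k : 'I_n -> int)
    (v : 'cV[R]_n) :
  dist (@sync_state R n) v <= norm2 (perp (shift2pi k v)).
Proof.
pose m := (\sum_i shift2pi k v i 0) / n%:R.
pose a : 'cV[R]_n := shift2pi (fun i => - k i) (const_mx m).
have -> : perp (shift2pi k v) = v - a.
  by rewrite -(shift2piB k v) shift2piK.
by apply: dist_le; exists k, m; rewrite shift2piK.
Qed.

(** A point of the torus close to the synchronized state has a lift close to the
diagonal; the lift [k] is the one that aligns the nearby synchronized point. *)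
Lemma dist_sync_state_lt (R : realType) (n : nat) (v : 'cV[R]_n) (d : R) :
  dist (@sync_state R n) v < d ->
  exists k, dist (@sync_line R n) (shift2pi k v) < d.
Proof.
move=> /(dist_lt (sync_state_neq0 R n))[a [k ka] va]; exists k.
by apply: le_lt_trans va; rewrite -(shift2piB k); exact: dist_le.
Qed.

Lemma norm2_perp_lt (R : realType) (n : nat) (v : 'cV[R]_n) (d : R) :
  (0 < n)%N -> dist (@sync_line R n) v < d -> norm2 (perp v) < d.
Proof.
move=> n0 /dist_lt[|a la va]; first by exists (const_mx 0), 0.
exact: le_lt_trans (norm2_perp_le _ n0 la) va.
Qed.

(** Invariance under [shift2pi] brings every point into the cube
[[0, 2 pi]^n].  The part [S] of the cube at distance at least [eps] from all
equilibria is compact, and the minimum of [|f|^2] on it is positive since a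
zero of [f] in [S] would be an equilibrium at distance [0] from itself. *)
Lemma small_field_near_equilibria (R : realType) (n : nat)
    (f : 'cV[R]_n -> 'cV[R]_n) :
  (forall k v, f (shift2pi k v) = f v) ->
  (forall (T : topologicalType) (F : T -> 'cV[R]_n),
    (forall i, continuous (fun x => F x i 0)) ->
    forall i, continuous (fun x => f (F x) i 0)) ->
  forall eps, 0 < eps -> exists2 m, 0 < m &
    forall v, dot (f v) (f v) < m -> dist (equilibria f) v < eps.
Proof.
move=> fshift fcont eps eps0.
pose S := [set x : 'rV[R]_n | (forall i, 0 <= x 0 i <= 2 * pi) /\
  forall a, equilibria f a -> eps ^+ 2 <= dot (x^T - a) (x^T - a)].
have ctr := @continuous_tr_coord R n.
have cf : continuous (fun x : 'rV[R]_n => dot (f x^T) (f x^T)).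
  by apply: continuous_dot; exact: fcont.
have cdist a : continuous (fun x : 'rV[R]_n => dot (x^T - a) (x^T - a)).
  have cB i : continuous (fun x : 'rV[R]_n => (x^T - a) i 0).
    have -> : (fun x : 'rV[R]_n => (x^T - a) i 0) = (fun x => x 0 i - a i 0).
      by apply/funext => x; rewrite !mxE.
    move=> x; apply: (@cvgB _ _ _ (nbhs x)); last exact: cvg_cst.
    exact: coord_continuous.
  exact: continuous_dot.
have Scompact : compact S.
  apply: (@subclosed_compact _ _ [set x : 'rV[R]_n |
    forall i, `[0, 2 * pi]%classic (x ord0 i)]).
  - have -> : S = \bigcap_(i in [set: 'I_n])
          ((fun x : 'rV[R]_n => x 0 i) @^-1` `[0, 2 * pi]%classic) `&`
        \bigcap_(a in equilibria f)
          ((fun x : 'rV[R]_n => dot (x^T - a) (x^T - a)) @^-1`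
            [set y | eps ^+ 2 <= y]).
      apply/seteqP; split => x [h1 h2]; split => //.
      - by move=> i _; rewrite /= in_itv/=; exact: h1.
      - by move=> i; have := h1 i I; rewrite /= in_itv.
    apply: closedI.
    + apply: closed_bigI => i _; apply: preimage_closed.
        by move=> x _; exact: coord_continuous.
      exact: interval_closed.
    + apply: closed_bigI => a _; apply: preimage_closed.
        by move=> x _; exact: cdist.
      exact: closed_ge.
  - apply: (@rV_compact _ _ (fun=> `[0, 2 * pi]%classic)) => i.
    exact: segment_compact.
  - by move=> x [h _] i /=; rewrite in_itv/=; exact: h.
have cube (v : 'cV[R]_n) : exists k, forall i, 0 <= (shift2pi k v)^T 0 i <= 2 * pi.
  by have [k hk] := shift2pi_cube v; exists k => i; rewrite mxE; exact: hk.
(* An equilibrium near the shifted point is shifted back by [- k]. *)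
have outside k v : (forall i, 0 <= (shift2pi k v)^T 0 i <= 2 * pi) ->
    ~ S (shift2pi k v)^T -> dist (equilibria f) v < eps.
  move=> hk /not_andP[//|/existsNP[a /not_implyP[fa /negP]]].
  rewrite -ltNge trmxK => h; pose b := shift2pi (fun i => - k i) a.
  have fb : equilibria f b by rewrite /equilibria/= fshift.
  apply: le_lt_trans (dist_le v fb) _.
  rewrite -(shift2piB k) shift2piK norm2E -(gtr0_norm eps0) -sqrtr_sqr.
  by rewrite ltr_sqrt// exprn_gt0.
have [[x0 Sx0]|S0] := pselect (S !=set0); last first.
  exists 1 => // v _; have [k hk] := cube v; apply: (outside k) => // Sv.
  by apply: S0; exists (shift2pi k v)^T.
have [x /set_mem[xcube xfar] xmin] := EVT_min_rV (ex_intro _ x0 Sx0) Scompact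
  (continuous_subspaceT cf).
exists (dot (f x^T) (f x^T)).
  rewrite lt_neqAle dot_ge0 andbT eq_sym; apply/eqP => /dot_eq0 /xfar.
  by rewrite subrr -(scale0r (0 : 'cV[R]_n)) dotZl mul0r leNgt exprn_gt0.
move=> v fv; have [k hk] := cube v; apply: (outside k) => // Sv.
have := xmin (shift2pi k v)^T (mem_set Sv).
by rewrite trmxK fshift leNgt fv.
Qed.

(** * The Kuramoto flow and its equilibria *)

Lemma halfline_deriv_mulmx (R : realType) (m n : nat) (A : 'M[R]_(m, n))
    (u du : R -> 'cV[R]_n) :
  (forall i, halfline_deriv (fun t => u t i 0) (fun t => du t i 0)) ->
  forall j, halfline_deriv (fun t => (A *m u t) j 0) (fun t => (A *m du t) j 0).
Proof.
move=> hu j.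
apply: halfline_deriv_eq (halfline_deriv_sum (fun i => halfline_derivZ (A j i) (hu i))).
  by move=> t; rewrite mxE.
by move=> t; rewrite mxE.
Qed.

Lemma halfline_deriv_perp (R : realType) (n : nat) (u du : R -> 'cV[R]_n) :
  (forall i, halfline_deriv (fun t => u t i 0) (fun t => du t i 0)) ->
  forall i, halfline_deriv (fun t => perp (u t) i 0) (fun t => perp (du t) i 0).
Proof.
move=> hu i.
have := halfline_derivD (hu i) (halfline_derivZ (- n%:R^-1) (halfline_deriv_sum hu)).
by apply: halfline_deriv_eq => t; rewrite !mxE mulNr mulrC.
Qed.

Lemma halfline_deriv_dot (R : realType) (n : nat) (u du : R -> 'cV[R]_n) :
  (forall i, halfline_deriv (fun t => u t i 0) (fun t => du t i 0)) ->
  halfline_deriv (fun t => dot (u t) (u t)) (fun t => 2 * dot (u t) (du t)).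
Proof.
move=> hu; have := halfline_deriv_sum (fun i => halfline_derivM (hu i) (hu i)).
apply: halfline_deriv_eq => t //; rewrite mulr_sumr; apply: eq_bigr => i _.
by rewrite mulr_natl mulr2n.
Qed.

Lemma trajectory_coord (R : realType) (N : nat) (f : 'cV[R]_N -> 'cV[R]_N)
    (theta : R -> 'cV[R]_N) :
  trajectory f theta ->
  forall i, halfline_deriv (fun t => theta t i 0) (fun t => f (theta t) i 0).
Proof.
move=> [ct dt] i; split.
  apply: (@within_continuous_comp _ _ _ _ theta (fun v : 'cV[R]_N => v i 0)) => //.
  by move=> x _; exact: coord_continuous.
move=> t /dt[dtheta Dtheta]; have := dtheta.
move=> /derivable_mxP/(_ i 0) di; apply: DeriveDef => //.
by rewrite -Dtheta derive_mx// mxE.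
Qed.

Lemma trajectory_shift2pi (R : realType) (N : nat) (f : 'cV[R]_N -> 'cV[R]_N)
    (theta : R -> 'cV[R]_N) (k : 'I_N -> int) :
  (forall v, f (shift2pi k v) = f v) ->
  trajectory f theta -> trajectory f (fun t => shift2pi k (theta t)).
Proof.
move=> fk [ct dt].
have -> : (fun t => shift2pi k (theta t)) =
    theta + cst (\col_i (2 * pi * (k i)%:~R)).
  by apply/funext => t; apply/matrixP => i j; rewrite !mxE ord1.
split.
  apply: within_continuousD => //.
  by apply: continuous_subspaceT => x; exact: cst_continuous.
move=> t /dt dtheta.
have -> : f ((theta + cst (\col_i (2 * pi * (k i)%:~R))) t) = f (theta t) + 0.
  rewrite addr0 -(fk (theta t)); congr f.
  by apply/matrixP => i j; rewrite !mxE ord1.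
exact: is_deriveD.
Qed.

Lemma kuramoto_coord (R : realType) (N e : nat) (K : R) (B : 'M[R]_(N, e))
    (v : 'cV[R]_N) i :
  kuramoto K B v i 0 = - (K / N%:R) * \sum_j B i j * sin ((B^T *m v) j 0).
Proof.
by rewrite mxE; congr (_ * _); rewrite mxE; apply: eq_bigr => j _; rewrite !mxE.
Qed.

Lemma kuramoto_continuous (R : realType) (N e : nat) (K : R) (B : 'M[R]_(N, e))
    (T : topologicalType) (F : T -> 'cV[R]_N) :
  (forall i, continuous (fun x => F x i 0)) ->
  forall i, continuous (fun x => kuramoto K B (F x) i 0).
Proof.
move=> cF i; have cB := continuous_mulmx_coord (A := B^T) cF.
have -> : (fun x => kuramoto K B (F x) i 0) =
    (fun x => - (K / N%:R) * (B *m map_mx (@sin R) (B^T *m F x)) i 0).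
  by apply/funext => x; rewrite mxE.
have cS j : continuous (fun x => map_mx (@sin R) (B^T *m F x) j 0).
  have -> : (fun x => map_mx (@sin R) (B^T *m F x) j 0) =
      @sin R \o (fun x => (B^T *m F x) j 0) by apply/funext => z; rewrite mxE.
  by move=> y; apply: continuous_comp; [exact: cB|exact: continuous_sin].
move=> x; apply: (@cvgM _ _ (nbhs x)); first exact: cvg_cst.
exact: (continuous_mulmx_coord (A := B) cS).
Qed.

Lemma kuramoto_shift2pi (R : realType) (N e : nat) (adj : rel 'I_N)
    (tail head : 'I_e -> 'I_N) (K : R) (k : 'I_N -> int) (v : 'cV[R]_N) :
  simple_graph adj -> orientation adj tail head ->
  kuramoto K (incidence R tail head) (shift2pi k v) =
  kuramoto K (incidence R tail head) v.
Proof.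
move=> hs ho; apply/matrixP => i c; rewrite ord1 !kuramoto_coord.
congr (_ * _); apply: eq_bigr => j _; congr (_ * _).
rewrite !(incidence_tr_coord _ _ hs ho) !mxE.
rewrite -[RHS](sin_period_int _ (k (head j) - k (tail j))); congr sin.
by rewrite rmorphB/=; ring.
Qed.

Lemma dot_kuramoto (R : realType) (N e : nat) (K : R) (B : 'M[R]_(N, e))
    (u v : 'cV[R]_N) :
  dot u (kuramoto K B v) =
  - (K / N%:R) * dot (B^T *m u) (map_mx (@sin R) (B^T *m v)).
Proof. by rewrite dotZr dot_mulmxl trmxK. Qed.

(** The gradient structure: the potential [F = \sum_j (1 - cos x_j)] is
nonnegative and its derivative [sin x . B^T f] equals [- (N / K) |f|^2], because
[B (sin x) = - (N / K) f]. *)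
Lemma kuramoto_coord_cvg0 (R : realType) (N e : nat) (adj : rel 'I_N)
    (tail head : 'I_e -> 'I_N) (K : R) (theta : R -> 'cV[R]_N) (i : 'I_N) :
  (0 < N)%N -> simple_graph adj -> orientation adj tail head -> 0 < K ->
  let f := kuramoto K (incidence R tail head) in
  trajectory f theta -> f (theta t) i 0 @[t --> +oo] --> (0 : R).
Proof.
move=> N0 hs ho K0 f htheta; pose B := incidence R tail head.
have KN0 : 0 < K / N%:R by rewrite divr_gt0// ltr0n.
have hcoord := trajectory_coord htheta.
have hx := halfline_deriv_mulmx B^T hcoord.
pose M := K / N%:R * e%:R.
have sumB (g : 'I_e -> R) (b : R) i0 : (forall j, `|g j| <= b) ->
    `|- (K / N%:R) * \sum_j B i0 j * g j| <= K / N%:R * (e%:R * b).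
  move=> gb; rewrite normrM normrN (gtr0_norm KN0) ler_pM2l//.
  apply: le_trans (ler_norm_sum _ _ _) _.
  apply: (@le_trans _ _ (\sum_(j < e) b)).
    apply: ler_sum => j _; rewrite normrM -[leRHS]mul1r.
    by apply: ler_pM => //; exact: incidence_coord_le1.
  by rewrite sumr_const card_ord mulr_natl.
have fM v i0 : `|f v i0 0| <= M.
  rewrite kuramoto_coord /M -(mulr1 e%:R); apply: sumB => j; exact: sin_max.
(* The edge differences of [f] are at most [2 * M]: [f_i] is Lipschitz. *)
have hfi : halfline_deriv (fun t => f (theta t) i 0)
    (fun t => - (K / N%:R) * \sum_j B i j *
      (cos ((B^T *m theta t) j 0) * (B^T *m f (theta t)) j 0)).
  have := halfline_derivZ (- (K / N%:R)) (halfline_deriv_sum (fun j =>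
    halfline_derivZ (B i j) (halfline_deriv_comp (@is_derive_sin R) (hx j)))).
  by apply: halfline_deriv_eq => // t; rewrite kuramoto_coord.
have hlip := halfline_deriv_Lipschitz hfi (fun t _ => sumB _ (2 * M) i _).
pose F t := \sum_j (1 - cos ((B^T *m theta t) j 0)).
have hF : halfline_deriv F (fun t => - (N%:R / K) * dot (f (theta t)) (f (theta t))).
  have := halfline_deriv_sum (fun j => halfline_derivD (halfline_deriv_cst 1)
    (halfline_derivZ (-1) (halfline_deriv_comp (@is_derive_cos R) (hx j)))).
  apply: halfline_deriv_eq => t.
    by apply: eq_bigr => j _; rewrite mulN1r.
  rewrite [in RHS]dot_kuramoto mulrA mulrNN.
  have -> : N%:R / K * (K / N%:R) = 1 :> R.
    by rewrite mulrA divfK ?gt_eqF// divff// gt_eqF// ltr0n.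
  rewrite mul1r; apply: eq_bigr => j _.
  by rewrite [map_mx _ _ _ _]mxE; ring.
apply: (dissipation_cvg0 (k := N%:R / K) _ _ hF _ _ (hlip _)).
- by rewrite divr_gt0// ltr0n.
- by rewrite !mulr_ge0 ?ler0n ?invr_ge0 ?ler0n ?(ltW K0).
- by move=> t; apply: sumr_ge0 => j _; rewrite subr_ge0 cos_le1.
- move=> t _; rewrite mulNr lerN2 ler_pM2l ?divr_gt0 ?ltr0n//.
  exact: dot_coord_le.
- move=> t j; rewrite normrM -[leRHS]mul1r ler_pM ?cos_max//.
  rewrite (incidence_tr_coord _ _ hs ho) (le_trans (ler_normB _ _))//.
  by rewrite mulr_natl mulr2n lerD.
Qed.

Lemma kuramoto_converges (R : realType) (N e : nat) (adj : rel 'I_N)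
    (tail head : 'I_e -> 'I_N) (K : R) (theta : R -> 'cV[R]_N) :
  (0 < N)%N -> simple_graph adj -> orientation adj tail head -> 0 < K ->
  let f := kuramoto K (incidence R tail head) in
  trajectory f theta -> converges_to_set theta (equilibria f).
Proof.
move=> N0 hs ho K0 f htheta.
have eq0 : equilibria f !=set0.
  exists 0; apply/matrixP => i c; rewrite ord1 kuramoto_coord mulmx0 mxE.
  by rewrite big1 ?mulr0// => j _; rewrite [X in sin X]mxE sin0 mulr0.
have hff : dot (f (theta t)) (f (theta t)) @[t --> +oo] --> (0 : R).
  have -> : 0 = \sum_(i < N) 0 * 0 :> R by rewrite big1// => i _; rewrite mulr0.
  apply: cvg_big => [|i _]; first exact: add_continuous.
  have fi0 : f (theta t) i 0 @[t --> +oo] --> (0 : R).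
    exact: (kuramoto_coord_cvg0 i N0 hs ho K0 htheta).
  exact: (cvgM fi0 fi0).
apply/cvgr0Pnorm_lt => eps eps0.
have [m m0 hm] := small_field_near_equilibria
  (fun k v => kuramoto_shift2pi K k v hs ho)
  (@kuramoto_continuous R N e K (incidence R tail head)) eps0.
move/cvgr0Pnorm_lt : hff => /(_ m m0); apply: filterS => t.
rewrite ger0_norm ?dot_ge0// => /hm.
by rewrite ger0_norm// dist_ge0.
Qed.

(** * Decay towards synchrony *)

(** The threshold [1 / 2] on the norm keeps every edge difference below [1] in
absolute value: [(a - b)^2 <= 2 (a^2 + b^2) <= 4 W < 1].  As [1 <= pi / 2], this
is inside the domain of [mul_sin_ge]. *)
Lemma sync_decay (R : realType) (N e : nat) (adj : rel 'I_N)
    (tail head : 'I_e -> 'I_N) (K mu : R) (theta : R -> 'cV[R]_N) :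
  (0 < N)%N -> simple_graph adj -> orientation adj tail head -> 0 < K ->
  let B := incidence R tail head in
  0 <= mu ->
  (forall w, dot w (const_mx 1) = 0 ->
    mu * dot w w <= dot (B^T *m w) (B^T *m w)) ->
  trajectory (kuramoto K B) theta -> norm2 (perp (theta 0)) < 1 / 2 ->
  forall t, 0 <= t -> norm2 (perp (theta t)) <=
    norm2 (perp (theta 0)) * expR (- (2 * K / (pi * N%:R) * mu * t)).
Proof.
move=> N0 hs ho K0 B mu0 gap htheta h0; set c := 2 * K / _ * mu.
have NR0 : 0 < N%:R :> R by rewrite ltr0n.
have pi0 : 0 < pi :> R := pi_gt0 R.
pose W t := dot (perp (theta t)) (perp (theta t)).
pose x t := B^T *m theta t.
have xE t : B^T *m perp (theta t) = x t.
  by rewrite mulmxBr (incidence_tr_const _ hs ho) subr0.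
pose dW t := - (2 * (K / N%:R) * dot (x t) (map_mx (@sin R) (x t))).
have hW : halfline_deriv W dW.
  have := halfline_deriv_dot (halfline_deriv_perp (trajectory_coord htheta)).
  apply: halfline_deriv_eq => t //.
  by rewrite dot_perp_perp// dot_kuramoto xE /dW; ring.
have c0 : 0 <= c.
  by rewrite !mulr_ge0 ?invr_ge0 ?mulr_ge0 ?(ltW K0) ?(ltW pi0) ?ler0n.
have dWle t : W t < 1 / 4 -> dW t <= - (2 * c * W t).
  move=> Wt; rewrite lerN2.
  have xj j : `|x t j 0| <= pi / 2.
    apply: le_trans (pihalf_ge1 R).
    rewrite -(@ler_pXn2r _ 2)// ?nnegrE// expr1n real_normK ?num_real//.
    rewrite -xE (incidence_tr_coord _ _ hs ho).
    move: Wt; rewrite /W; move: (perp (theta t)) => p.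
    have := dot_coord_le p (head j); have := dot_coord_le p (tail j).
    have := sqr_ge0 (p (head j) 0 + p (tail j) 0).
    rewrite !expr2; nra.
  have sinx : 2 / pi * dot (x t) (x t) <= dot (x t) (map_mx (@sin R) (x t)).
    rewrite mulr_sumr; apply: ler_sum => j _.
    by rewrite [map_mx _ _ _ _]mxE -expr2; exact: mul_sin_ge.
  have gapt : mu * W t <= dot (x t) (x t).
    by rewrite -xE; apply: gap; exact: dot_perp_const.
  have -> : 2 * c * W t = 2 * (K / N%:R) * (2 / pi * (mu * W t)).
    rewrite /c; have : pi != 0 :> R by rewrite gt_eqF.
    have : N%:R != 0 :> R by rewrite gt_eqF.
    move: (pi : R) (N%:R : R) (W t) => p n w n0 p0.
    by field; rewrite n0 p0.
  rewrite ler_wpM2l ?mulr_ge0 ?invr_ge0 ?(ltW K0) ?(ltW NR0)//.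
  by apply: le_trans sinx; rewrite ler_wpM2l// divr_ge0// ltW.
have W0 : W 0 < 1 / 4.
  have -> : 1 / 4 = (1 / 2) ^+ 2 :> R by field.
  move: h0; rewrite norm2E -/(W 0) -(@ltr_pXn2r _ 2)// ?nnegrE ?sqrtr_ge0//.
  by rewrite sqr_sqrtr ?dot_ge0.
have Wsmall : forall t, 0 <= t -> W t < 1 / 4.
  apply: (sublevel_trapping hW) => // t _ /dWle dWt; apply: le_trans dWt _.
  by rewrite oppr_le0 mulr_ge0 ?dot_ge0// mulr_ge0.
move=> t t0.
have := Gronwall_decay hW (fun t ht => dWle t (Wsmall t (ltW ht))) t0.
have -> : - (2 * c * t) = - (c * t) + - (c * t) by ring.
rewrite expRD -expr2 !norm2E -/(W t) -/(W 0) => Wt.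
rewrite -[X in _ * X]ger0_norm ?expR_ge0// -sqrtr_sqr -sqrtrM ?dot_ge0//.
by rewrite ler_sqrt// mulr_ge0 ?dot_ge0 ?sqr_ge0.
Qed.

Theorem theorem1 (R : realType) (N e : nat) (adj : rel 'I_N)
    (tail head : 'I_e -> 'I_N) (K : R)
    (hN : (0 < N)%N)
    (hgraph : simple_graph adj)
    (hconn : connected_graph adj)
    (horient : orientation adj tail head)
    (hK : 0 < K) :
  let B := incidence R tail head in
  let L := laplacian B in
  let f := kuramoto K B in
  (forall theta : R -> 'cV[R]_N, trajectory f theta ->
     converges_to_set theta (equilibria f)) /\
  locally_asymptotically_stable f (@sync_state R N) /\
  sync_rate_at_least f (2 * K / (pi * N%:R) * lambda2 L).
Proof.
move=> B L f; split.
  by move=> theta; exact: kuramoto_converges hN hgraph horient hK.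
have [mu [mu0 Lmu gap]] := spectral_gap R hgraph hconn horient.
have rate0 : 0 < 2 * K / (pi * N%:R).
  by rewrite divr_gt0 ?mulr_gt0 ?pi_gt0 ?ltr0n.
set c := _ * lambda2 L; pose c' := 2 * K / (pi * N%:R) * mu.
have c'0 : 0 < c' by rewrite mulr_gt0.
have half0 : 0 < 1 / 2 :> R by rewrite divr_gt0.
(* All local claims are made for the lift along which the phases are close. *)
have near_sync (theta : R -> 'cV[R]_N) d : trajectory f theta -> d <= 1 / 2 ->
    dist (@sync_state R N) (theta 0) < d ->
    exists2 k, dist (@sync_line R N) (shift2pi k (theta 0)) < d &
      forall t, 0 <= t ->
        norm2 (perp (shift2pi k (theta t))) <= d * expR (- (c' * t)).
  move=> htheta d12 /dist_sync_state_lt[k hk]; exists k => // t t0.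
  have pd := norm2_perp_lt hN hk.
  have hshift := trajectory_shift2pi
    (fun v => kuramoto_shift2pi K k v hgraph horient) htheta.
  have := sync_decay hN hgraph horient hK (ltW mu0) gap hshift
    (lt_le_trans pd d12) t0.
  by move=> /le_trans; apply; rewrite ler_wpM2r ?expR_ge0// ltW.
split; [split|].
- move=> eps eps0; have eps20 : 0 < eps / 2 by rewrite divr_gt0.
  have d12 : Num.min (eps / 2) (1 / 2) <= 1 / 2 by rewrite ge_min lexx orbT.
  (* Halving [eps] makes the final inequality strict. *)
  exists (Num.min (eps / 2) (1 / 2)); first by rewrite lt_min eps20.
  move=> theta htheta h0 t t0.
  have [k _ decay] := near_sync theta _ htheta d12 h0.
  apply: le_lt_trans (dist_sync_state_le k _) _.
  apply: le_lt_trans (decay t t0) _; apply: (@le_lt_trans _ _ (eps / 2)).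
    rewrite -[leRHS]mulr1; apply: ler_pM; rewrite ?expR_ge0 ?ge_min ?lexx//.
      by rewrite le_min !ltW.
    by rewrite expR_le1 oppr_le0 mulr_ge0// ltW.
  by rewrite ltr_pdivrMr// ltr_pMr// ltr1n.
- exists (1 / 2) => // theta htheta h0.
  have [k _ decay] := near_sync theta _ htheta (lexx _) h0.
  apply: (squeeze_cvgr _ (cvg_cst 0) (expR_decay_cvg0 c'0)).
  exists 0; split => // t /ltW t0; rewrite dist_ge0/=; last exact: sync_state_neq0.
  apply: le_trans (dist_sync_state_le k _) _; apply: le_trans (decay t t0) _.
  by rewrite ger_pMl ?expR_gt0// ler_pdivrMr// mul1r ler1n.
exists (1 / 2), (1 / 2); split => // theta htheta h0.
have [k hk decay] := near_sync theta _ htheta (lexx _) h0.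
exists k; split => // t t0; apply: le_trans (decay t t0) _.
rewrite ler_wpM2l ?(ltW half0)// ler_expR lerN2 ler_wpM2r//.
by rewrite ler_wpM2l// ltW.
Qed.
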